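(* Let $\mathcal W$ be a class of objects of $\mathcal C$ which is closed under finite direct sums. Let $$Y\to Y^0\to Y^1\dashrightarrow\qquad (T)$$ be a $\mathcal C(-,\mathcal W)$-exact $\mathbb E$-triangle in $\xi$, and let $$0\to Y^0\to W_0^0\to W_1^0\to\cdots\to W_n^0\to\cdots\qquad (R^0)$$ $$0\to Y^1\to W_0^1\to W_1^1\to\cdots\to W_{n-1}^1\to\cdots\qquad (R^1)$$ be coproper $\mathcal W(\xi)$-coresolutions of $Y^0$ and $Y^1$, respectively. (1) There is a coproper $\mathcal W(\xi)$-coresolution of $Y$ of the form $$0\to Y\to W_0^0\to W_1^0\oplus W_0^1\to W_2^0\oplus W_1^1\to\cdots\to W_n^0\oplus W_{n-1}^1\to\cdots.\qquad (R)$$ (2) If, in addition, the $\xi$-exact complexes $(R^0)$, $(R^1)$ and the $\mathbb E$-triangle $(T)$ are $\mathcal C(\mathcal W,-)$-exact, then so is the complex $(R)$ obtained in (1) (that is, the coresolution in (1) can be taken such that it is moreover $\mathcal C(\mathcal W,-)$-exact).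
   Context: Extriangulated categories (Nakaoka–Palu). Let $\mathcal C$ be an additive category with an additive bifunctor $\mathbb E:\mathcal C^{\mathrm{op}}\times\mathcal C\to\mathrm{Ab}$. For $\delta\in\mathbb E(C,A)$, $a:A\to A'$, $c:C'\to C$ write $a_*\delta=\mathbb E(C,a)(\delta)$, $c^*\delta=\mathbb E(c,A)(\delta)$. For $\delta\in\mathbb E(C,A)$, $\delta'\in\mathbb E(C',A')$, a morphism $(a,c):\delta\to\delta'$ is a pair $a:A\to A'$, $c:C\to C'$ with $a_*\delta=c^*\delta'$. Two sequences $A\xrightarrow{x}B\xrightarrow{y}C$ and $A\xrightarrow{x'}B'\xrightarrow{y'}C$ are equivalent if there is an isomorphism $b:B\to B'$ with $bx=x'$, $y'b=y$. A realization $\mathfrak s$ assigns to each $\delta\in\mathbb E(C,A)$ an equivalence class $\mathfrak s(\delta)=[A\xrightarrow{x}B\xrightarrow{y}C]$ such that for every morphism $(a,c):\delta\to\delta'$ with $\mathfrak s(\delta)=[A\xrightarrow{x}B\xrightarrow{y}C]$, $\mathfrak s(\delta')=[A'\xrightarrow{x'}B'\xrightarrow{y'}C']$ there is $b:B\to B'$ with $bx=x'a$, $y'b=cy$. It is additive if $\mathfrak s(0)=[A\to A\oplus C\to C]$ (canonical maps) and $\mathfrak s(\delta\oplus\delta')=\mathfrak s(\delta)\oplus\mathfrak s(\delta')$. If $\mathfrak s(\delta)=[A\xrightarrow{x}B\xrightarrow{y}C]$, one calls $A\xrightarrow{x}B\xrightarrow{y}C\overset{\delta}{\dashrightarrow}$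 an $\mathbb E$-triangle, $x$ an inflation and $y$ a deflation. $(\mathcal C,\mathbb E,\mathfrak s)$ is extriangulated if $\mathfrak s$ is an additive realization and: (ET3) for $\mathbb E$-triangles $A\xrightarrow{x}B\xrightarrow{y}C\overset{\delta}{\dashrightarrow}$ and $A'\xrightarrow{x'}B'\xrightarrow{y'}C'\overset{\delta'}{\dashrightarrow}$ and morphisms $a:A\to A'$, $b:B\to B'$ with $bx=x'a$ there is $c:C\to C'$ with $cy=y'b$ and $a_*\delta=c^*\delta'$; (ET3)$^{\mathrm{op}}$ the dual; (ET4) for $\mathbb E$-triangles $A\xrightarrow{f}B\xrightarrow{f'}D\overset{\delta}{\dashrightarrow}$ and $B\xrightarrow{g}C\xrightarrow{g'}F\overset{\delta'}{\dashrightarrow}$ there are an $\mathbb E$-triangle $A\xrightarrow{gf}C\xrightarrow{h'}H\overset{\delta''}{\dashrightarrow}$ and morphisms $d:D\to H$, $e:H\to F$ with $h'g=df'$, $eh'=g'$, such that $D\xrightarrow{d}H\xrightarrow{e}F$ realizes $f'_*\delta'$, $d^*\delta''=\delta$ and $f_*\delta''=e^*\delta'$; (ET4)$^{\mathrm{op}}$ the dual. Proper classes. An $\mathbb E$-triangle is split if $\delta=0$. A class $\xi$ of $\mathbb E$-triangles closed under isomorphisms is a proper class if: (i) it is closed under finite coproducts and contains all split $\mathbb E$-triangles; (ii) it is closed under base change (if the $\mathbb E$-triangle realizing $\delta\in\mathbb E(C,A)$ is in $\xi$ and $c:C'\to C$, then any $\mathbb E$-triangle realizing $c^*\delta$ is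 in $\xi$) and cobase change (likewise for $a_*\delta$, $a:A\to A'$); (iii) it is saturated: if $A_1\to B_1\to C\overset{\delta_1}{\dashrightarrow}$ and $A_2\to B_2\xrightarrow{y_2}C\overset{\delta_2}{\dashrightarrow}$ are $\mathbb E$-triangles such that the second one and the $\mathbb E$-triangle $A_1\to M\to B_2\overset{y_2^*\delta_1}{\dashrightarrow}$ are in $\xi$, then the first one is in $\xi$. An object $P$ is $\xi$-projective if $0\to\mathcal C(P,A)\to\mathcal C(P,B)\to\mathcal C(P,C)\to0$ is exact for every $\mathbb E$-triangle $A\to B\to C\dashrightarrow$ in $\xi$; $\xi$-injective is dual. $\mathcal C$ has enough $\xi$-projectives (resp. $\xi$-injectives) if each object $A$ admits an $\mathbb E$-triangle $K\to P\to A\dashrightarrow$ (resp. $A\to I\to K\dashrightarrow$) in $\xi$ with $P$ $\xi$-projective (resp. $I$ $\xi$-injective). Standing assumptions. $(\mathcal C,\mathbb E,\mathfrak s)$ is an extriangulated category, $\xi$ is a proper class of $\mathbb E$-triangles, $\mathcal C$ has enough $\xi$-projectives and enough $\xi$-injectives, and Condition (WIC) holds: for composable $f,g$, if $gf$ is an inflation then so is $f$, and if $gf$ is a deflation then so is $g$. Exactness. For a class $\mathcal W$ of objects, an $\mathbb E$-triangle $A\to B\to C\dashrightarrow$ in $\xi$ is $\mathcal C(\mathcal W,-)$-exact (resp. $\mathcal C(-,\mathcal W)$-exact) if $0\to\mathcal C(W,A)\to\mathcal C(W,B)\to\mathcal C(W,C)\to0$ (resp. $0\to\mathcal C(C,W)\to\mathcal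 C(B,W)\to\mathcal C(A,W)\to0$) is exact for all $W\in\mathcal W$. Coresolutions. A $\mathcal W(\xi)$-coresolution of $A$ is a $\xi$-exact complex $0\to A\xrightarrow{d^0}W^0\xrightarrow{d^1}W^1\to\cdots$ with all $W^i\in\mathcal W$; $\xi$-exact means there are $\mathbb E$-triangles $K^i\xrightarrow{g^i}W^i\xrightarrow{f^i}K^{i+1}\dashrightarrow$ in $\xi$ ($i\ge0$) with $K^0=A$, $d^0=g^0$ and $d^{i}=g^{i}f^{i-1}$ for $i\ge1$. The complex is $\mathcal C(\mathcal W,-)$-exact (resp. $\mathcal C(-,\mathcal W)$-exact) if these $\mathbb E$-triangles can be chosen $\mathcal C(\mathcal W,-)$-exact (resp. $\mathcal C(-,\mathcal W)$-exact). A $\mathcal W(\xi)$-coresolution is coproper if it is $\mathcal C(-,\mathcal W)$-exact. *)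

(* Defs.v *)
From mathcomp Require Import all_boot all_order all_algebra.

Set Implicit Arguments.
Unset Strict Implicit.
Unset Printing Implicit Defensive.

Import GRing.Theory.
Local Open Scope ring_scope.

Reserved Notation "g \co f" (at level 40, left associativity).
Reserved Notation "A \osum B" (at level 50, left associativity).

(** * Additive categories *)

Record addcat := AddCat {
  ob :> Type;
  mor : ob -> ob -> zmodType;
  idm : forall A, mor A A;
  mcomp : forall A B D, mor B D -> mor A B -> mor A D;
  mcompA : forall A B D F (h : mor D F) (g : mor B D) (f : mor A B),
    mcomp h (mcomp g f) = mcomp (mcomp h g) f;
  mcomp1m : forall A B (f : mor A B), mcomp (idm B) f = f;
  mcompm1 : forall A B (f : mor A B), mcomp f (idm A) = f;
  mcompDl : forall A B D (g g' : mor B D) (f : mor A B),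
    mcomp (g + g') f = mcomp g f + mcomp g' f;
  mcompDr : forall A B D (g : mor B D) (f f' : mor A B),
    mcomp g (f + f') = mcomp g f + mcomp g f';
  zob : ob;
  idm_zob : idm zob = 0;
  dsum : ob -> ob -> ob;
  in1 : forall A B, mor A (dsum A B);
  in2 : forall A B, mor B (dsum A B);
  pr1 : forall A B, mor (dsum A B) A;
  pr2 : forall A B, mor (dsum A B) B;
  pr1_in1 : forall A B, mcomp (pr1 A B) (in1 A B) = idm A;
  pr2_in2 : forall A B, mcomp (pr2 A B) (in2 A B) = idm B;
  pr1_in2 : forall A B, mcomp (pr1 A B) (in2 A B) = 0;
  pr2_in1 : forall A B, mcomp (pr2 A B) (in1 A B) = 0;
  in_pr_id : forall A B,
    mcomp (in1 A B) (pr1 A B) + mcomp (in2 A B) (pr2 A B) = idm (dsum A B)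
}.

Arguments mor {a} _ _.
Arguments idm {a} A.
Arguments zob {a}.
Arguments dsum {a} _ _.
Arguments in1 {a} A B.
Arguments in2 {a} A B.
Arguments pr1 {a} A B.
Arguments pr2 {a} A B.

Notation "g \co f" := (mcomp g f).
Notation "A \osum B" := (dsum A B).

Definition is_iso (C : addcat) (A B : C) (f : mor A B) : Prop :=
  exists g : mor B A, g \co f = idm A /\ f \co g = idm B.

Definition sum_mor (C : addcat) (A A' B B' : C)
    (f : mor A B) (f' : mor A' B') : mor (A \osum A') (B \osum B') :=
  in1 B B' \co f \co pr1 A A' + in2 B B' \co f' \co pr2 A A'.

(** * Extriangulated categories *)

(* [Ext D A] is E(D, A), contravariant in [D] and covariant in [A];
   [push a d] is a_* d and [pull c d] is c^* d.
   [realizes x y d] means that the sequence (x, y) belongs to the equivalence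
   class s(d); that s(d) is an equivalence class is part of [realization]. *)
Record extdata := ExtData {
  ext_cat :> addcat;
  Ext : ext_cat -> ext_cat -> zmodType;
  push : forall D A A' : ext_cat, mor A A' -> Ext D A -> Ext D A';
  pull : forall D D' A : ext_cat, mor D' D -> Ext D A -> Ext D' A;
  realizes : forall A B D : ext_cat, mor A B -> mor B D -> Ext D A -> Prop
}.

Arguments Ext {e} _ _.
Arguments push {e D A A'} a d.
Arguments pull {e D D' A} c d.
Arguments realizes {e A B D} x y d.

Section Extriangulated.
Variable C : extdata.

Record additive_bifunctor : Prop := AdditiveBifunctor {
  push_id : forall (D A : C) (d : Ext D A), push (idm A) d = d;
  push_comp : forall (D A A' A'' : C) (a' : mor A' A'') (a : mor A A')
    (d : Ext D A), push (a' \co a) d = push a' (push a d);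
  pull_id : forall (D A : C) (d : Ext D A), pull (idm D) d = d;
  pull_comp : forall (D D' D'' A : C) (c : mor D' D) (c' : mor D'' D')
    (d : Ext D A), pull (c \co c') d = pull c' (pull c d);
  push_pull : forall (D D' A A' : C) (a : mor A A') (c : mor D' D)
    (d : Ext D A), push a (pull c d) = pull c (push a d);
  push_ext_add : forall (D A A' : C) (a : mor A A') (d d' : Ext D A),
    push a (d + d') = push a d + push a d';
  pull_ext_add : forall (D D' A : C) (c : mor D' D) (d d' : Ext D A),
    pull c (d + d') = pull c d + pull c d';
  push_mor_add : forall (D A A' : C) (a a' : mor A A') (d : Ext D A),
    push (a + a') d = push a d + push a' d;
  pull_mor_add : forall (D D' A : C) (c c' : mor D' D) (d : Ext D A),
    pull (c + c') d = pull c d + pull c' d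
}.

(* The element of E(D (+) D', A (+) A') whose components in E(D, A),
   E(D', A'), E(D, A') and E(D', A) are d, d', 0 and 0. *)
Definition sum_ext (D A D' A' : C) (d : Ext D A) (d' : Ext D' A') :
    Ext (D \osum D') (A \osum A') :=
  push (in1 A A') (pull (pr1 D D') d) + push (in2 A A') (pull (pr2 D D') d').

Definition ext_mor (D A D' A' : C) (d : Ext D A) (d' : Ext D' A')
    (a : mor A A') (c : mor D D') : Prop :=
  push a d = pull c d'.

Definition seq_equiv (A B B' D : C) (x : mor A B) (y : mor B D)
    (x' : mor A B') (y' : mor B' D) : Prop :=
  exists b : mor B B', [/\ is_iso b, b \co x = x' & y' \co b = y].

Record realization : Prop := Realization {
  realizes_ex : forall (D A : C) (d : Ext D A),
    exists (B : C) (x : mor A B) (y : mor B D), realizes x y d;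
  realizes_uniq : forall (D A B B' : C) (d : Ext D A)
    (x : mor A B) (y : mor B D) (x' : mor A B') (y' : mor B' D),
    realizes x y d -> realizes x' y' d -> seq_equiv x y x' y';
  realizes_equiv : forall (D A B B' : C) (d : Ext D A)
    (x : mor A B) (y : mor B D) (x' : mor A B') (y' : mor B' D),
    realizes x y d -> seq_equiv x y x' y' -> realizes x' y' d;
  realizes_mor : forall (A B D A' B' D' : C)
    (x : mor A B) (y : mor B D) (d : Ext D A)
    (x' : mor A' B') (y' : mor B' D') (d' : Ext D' A')
    (a : mor A A') (c : mor D D'),
    realizes x y d -> realizes x' y' d' -> ext_mor d d' a c ->
    exists b : mor B B', b \co x = x' \co a /\ y' \co b = c \co y
}.

Record additive_realization : Prop := AdditiveRealization {
  add_realization : realization;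
  realizes0 : forall A D : C, realizes (in1 A D) (pr2 A D) (0 : Ext D A);
  realizes_sum : forall (A B D A' B' D' : C)
    (x : mor A B) (y : mor B D) (d : Ext D A)
    (x' : mor A' B') (y' : mor B' D') (d' : Ext D' A'),
    realizes x y d -> realizes x' y' d' ->
    realizes (sum_mor x x') (sum_mor y y') (sum_ext d d')
}.

Definition inflation (A B : C) (x : mor A B) : Prop :=
  exists (D : C) (y : mor B D) (d : Ext D A), realizes x y d.

Definition deflation (B D : C) (y : mor B D) : Prop :=
  exists (A : C) (x : mor A B) (d : Ext D A), realizes x y d.

Definition ET3 : Prop :=
  forall (A B D A' B' D' : C)
    (x : mor A B) (y : mor B D) (d : Ext D A)
    (x' : mor A' B') (y' : mor B' D') (d' : Ext D' A')
    (a : mor A A') (b : mor B B'),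
    realizes x y d -> realizes x' y' d' -> b \co x = x' \co a ->
    exists c : mor D D', c \co y = y' \co b /\ ext_mor d d' a c.

Definition ET3op : Prop :=
  forall (A B D A' B' D' : C)
    (x : mor A B) (y : mor B D) (d : Ext D A)
    (x' : mor A' B') (y' : mor B' D') (d' : Ext D' A')
    (b : mor B B') (c : mor D D'),
    realizes x y d -> realizes x' y' d' -> c \co y = y' \co b ->
    exists a : mor A A', b \co x = x' \co a /\ ext_mor d d' a c.

Definition ET4 : Prop :=
  forall (A B D G F : C)
    (f : mor A B) (f' : mor B D) (d : Ext D A)
    (g : mor B G) (g' : mor G F) (d' : Ext F B),
    realizes f f' d -> realizes g g' d' ->
    exists (H : C) (h' : mor G H) (d'' : Ext H A) (u : mor D H) (v : mor H F),
      [/\ realizes (g \co f) h' d'',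
          h' \co g = u \co f' /\ v \co h' = g',
          realizes u v (push f' d'),
          pull u d'' = d &
          push f d'' = pull v d'].

Definition ET4op : Prop :=
  forall (A B D G F : C)
    (f' : mor D B) (f : mor B A) (d : Ext A D)
    (g' : mor F G) (g : mor G B) (d' : Ext B F),
    realizes f' f d -> realizes g' g d' ->
    exists (H : C) (h' : mor H G) (d'' : Ext A H) (u : mor H D) (v : mor F H),
      [/\ realizes h' (f \co g) d'',
          g \co h' = f' \co u /\ h' \co v = g',
          realizes v u (pull f' d'),
          push u d'' = d &
          pull f d'' = push v d'].

Record extriangulated : Prop := Extriangulated {
  extri_bifunctor : additive_bifunctor;
  extri_realization : additive_realization;
  extri_ET3 : ET3;
  extri_ET3op : ET3op;
  extri_ET4 : ET4;
  extri_ET4op : ET4op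
}.

Definition WIC : Prop :=
  (forall (A B D : C) (f : mor A B) (g : mor B D),
      inflation (g \co f) -> inflation f) /\
  (forall (A B D : C) (f : mor A B) (g : mor B D),
      deflation (g \co f) -> deflation g).

(** * Proper classes *)

Definition tri_class : Type :=
  forall A B D : C, mor A B -> mor B D -> Ext D A -> Prop.

Record proper_class (xi : tri_class) : Prop := ProperClass {
  proper_tri : forall (A B D : C) (x : mor A B) (y : mor B D) (d : Ext D A),
    xi A B D x y d -> realizes x y d;
  proper_iso : forall (A B D A' B' D' : C)
    (x : mor A B) (y : mor B D) (d : Ext D A)
    (x' : mor A' B') (y' : mor B' D') (d' : Ext D' A')
    (a : mor A A') (b : mor B B') (c : mor D D'),
    xi A B D x y d -> realizes x' y' d' ->
    [/\ is_iso a, is_iso b & is_iso c] ->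
    b \co x = x' \co a -> y' \co b = c \co y -> ext_mor d d' a c ->
    xi A' B' D' x' y' d';
  proper_sum : forall (A B D A' B' D' : C)
    (x : mor A B) (y : mor B D) (d : Ext D A)
    (x' : mor A' B') (y' : mor B' D') (d' : Ext D' A'),
    xi A B D x y d -> xi A' B' D' x' y' d' ->
    xi _ _ _ (sum_mor x x') (sum_mor y y') (sum_ext d d');
  proper_split : forall (A B D : C) (x : mor A B) (y : mor B D),
    realizes x y (0 : Ext D A) -> xi A B D x y 0;
  proper_base : forall (A B D B' D' : C)
    (x : mor A B) (y : mor B D) (d : Ext D A) (c : mor D' D)
    (x' : mor A B') (y' : mor B' D'),
    xi A B D x y d -> realizes x' y' (pull c d) ->
    xi A B' D' x' y' (pull c d);
  proper_cobase : forall (A B D A' B' : C)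
    (x : mor A B) (y : mor B D) (d : Ext D A) (a : mor A A')
    (x' : mor A' B') (y' : mor B' D),
    xi A B D x y d -> realizes x' y' (push a d) ->
    xi A' B' D x' y' (push a d);
  proper_saturated : forall (A1 B1 A2 B2 D M : C)
    (x1 : mor A1 B1) (y1 : mor B1 D) (d1 : Ext D A1)
    (x2 : mor A2 B2) (y2 : mor B2 D) (d2 : Ext D A2)
    (m : mor A1 M) (e : mor M B2),
    realizes x1 y1 d1 -> xi A2 B2 D x2 y2 d2 ->
    xi A1 M B2 m e (pull y2 d1) ->
    xi A1 B1 D x1 y1 d1
}.

(* Exactness of 0 -> U -> V -> W -> 0. *)
Definition short_exact (U V W : zmodType) (f : U -> V) (g : V -> W) : Prop :=
  [/\ injective f,
      forall v, g v = 0 <-> exists u, f u = v &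
      forall w, exists v, g v = w].

Definition hom_from_exact (P A B D : C) (x : mor A B) (y : mor B D) : Prop :=
  short_exact (fun h : mor P A => x \co h) (fun h : mor P B => y \co h).

Definition hom_to_exact (I A B D : C) (x : mor A B) (y : mor B D) : Prop :=
  short_exact (fun h : mor D I => h \co y) (fun h : mor B I => h \co x).

Definition xi_projective (xi : tri_class) (P : C) : Prop :=
  forall (A B D : C) (x : mor A B) (y : mor B D) (d : Ext D A),
    xi A B D x y d -> hom_from_exact P x y.

Definition xi_injective (xi : tri_class) (I : C) : Prop :=
  forall (A B D : C) (x : mor A B) (y : mor B D) (d : Ext D A),
    xi A B D x y d -> hom_to_exact I x y.

Definition enough_projectives (xi : tri_class) : Prop :=
  forall A : C, exists (K P : C) (x : mor K P) (y : mor P A) (d : Ext A K),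
    xi_projective xi P /\ xi K P A x y d.

Definition enough_injectives (xi : tri_class) : Prop :=
  forall A : C, exists (I K : C) (x : mor A I) (y : mor I K) (d : Ext K A),
    xi_injective xi I /\ xi A I K x y d.

(** * Coresolutions *)

Definition closed_dsum (W : C -> Prop) : Prop :=
  forall A B : C, W A -> W B -> W (A \osum B).

(* C(W, -)-exactness and C(-, W)-exactness of a sequence A -> B -> D. *)
Definition from_exact (W : C -> Prop) (A B D : C)
    (x : mor A B) (y : mor B D) : Prop :=
  forall V : C, W V -> hom_from_exact V x y.

Definition to_exact (W : C -> Prop) (A B D : C)
    (x : mor A B) (y : mor B D) : Prop :=
  forall V : C, W V -> hom_to_exact V x y.

(* The objects A, K 0, K 1, ...: the cosyzygies K^0, K^1, K^2, ... of A. *)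
Definition cosyzygy (A : C) (K : nat -> C) (i : nat) : C :=
  if i is j.+1 then K j else A.

(* [xi_exact_with xi Q d0 d]: the sequence
     0 -> A -d0-> X 0 -d 0-> X 1 -d 1-> X 2 -> ...
   splits into triangles of xi satisfying Q.  Thus [d i] is the differential
   d^{i+1}, and [f i : X i -> K i] ends at the cosyzygy K^{i+1}. *)
Definition xi_exact_with (xi : tri_class)
    (Q : forall A B D : C, mor A B -> mor B D -> Prop)
    (A : C) (X : nat -> C) (d0 : mor A (X 0%N))
    (d : forall i, mor (X i) (X i.+1)) : Prop :=
  exists (K : nat -> C) (g : forall i, mor (cosyzygy A K i) (X i))
    (f : forall i, mor (X i) (K i)) (e : forall i, Ext (K i) (cosyzygy A K i)),
    [/\ g 0%N = d0,
        forall i, g i.+1 \co f i = d i,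
        forall i, xi _ _ _ (g i) (f i) (e i) &
        forall i, Q _ _ _ (g i) (f i)].

Definition xi_exact (xi : tri_class) (A : C) (X : nat -> C)
    (d0 : mor A (X 0%N)) (d : forall i, mor (X i) (X i.+1)) : Prop :=
  xi_exact_with xi (fun _ _ _ _ _ => True) d0 d.

Definition coresolution (xi : tri_class) (W : C -> Prop) (A : C)
    (X : nat -> C) (d0 : mor A (X 0%N)) (d : forall i, mor (X i) (X i.+1)) :
    Prop :=
  (forall i, W (X i)) /\ xi_exact xi d0 d.

Definition complex_from_exact (xi : tri_class) (W : C -> Prop) (A : C)
    (X : nat -> C) (d0 : mor A (X 0%N)) (d : forall i, mor (X i) (X i.+1)) :
    Prop :=
  xi_exact_with xi (@from_exact W) d0 d.

Definition complex_to_exact (xi : tri_class) (W : C -> Prop) (A : C)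
    (X : nat -> C) (d0 : mor A (X 0%N)) (d : forall i, mor (X i) (X i.+1)) :
    Prop :=
  xi_exact_with xi (@to_exact W) d0 d.

Definition coproper_coresolution (xi : tri_class) (W : C -> Prop) (A : C)
    (X : nat -> C) (d0 : mor A (X 0%N)) (d : forall i, mor (X i) (X i.+1)) :
    Prop :=
  coresolution xi W d0 d /\ complex_to_exact xi W d0 d.

(* The objects X 0, X 1 (+) X' 0, X 2 (+) X' 1, ... *)
Definition shifted_dsum (X X' : nat -> C) (i : nat) : C :=
  if i is j.+1 then X j.+1 \osum X' j else X 0%N.

End Extriangulated.

(* Main.v *)
Require Import Defs.
From mathcomp Require Import all_boot all_algebra.
From Stdlib Require Import ClassicalEpsilon.

(** Since (T) embeds Y into Y^0 and (R^0) embeds Y^0 into W_0^0, the composite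
    Y -> W_0^0 is an inflation, and by (ET4) its cone H is an extension of the
    next cosyzygy K of Y^0 by Y^1.  The triangle Y -> W_0^0 -> H is in xi
    because xi is saturated ([xi_composite]).

    Push this extension out along Y^1 -> W_0^1, the start of (R^1).  As
    W_0^1 is in W and (R^0) is C(-, W)-exact, the map Y^0 -> Y^1 -> W_0^1
    extends to W_0^0, so the pushout splits.  Reading the pushout square in
    the other direction, H embeds into W_0^1 + K, and the quotient is the next
    cosyzygy of Y^1 ([cobase_change_splitting], [exact_tri_compose]).  Adding
    W_0^1 to the triangle that embeds K into W_1^0 gives a triangle that embeds
    W_0^1 + K into W_1^0 + W_0^1 ([exact_tri_dsum]).  So H is in the same
    position as Y was: it is the first term of a triangle whose other terms
    embed into objects of W of the required form.  Iterating with dependent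
    choice and splicing the triangles obtained gives (R).

    Composition and cobase change preserve C(-, W)-exactness, and in this
    situation also C(W, -)-exactness, which gives (2).  One point needs care
    there: C(-, W)-exactness and C(W, -)-exactness of (R^0) and (R^1) may be
    witnessed by different decompositions into triangles.  However the
    decomposition of a coproper coresolution is unique up to isomorphism
    ([decomposition_iso]), so a single one has both properties. *)

Set Implicit Arguments.
Unset Strict Implicit.
Unset Printing Implicit Defensive.

Import GRing.Theory.

(** * Composition in additive categories *)

Section Additive.
Local Open Scope ring_scope.
Variable C : addcat.

Lemma comp0m (A B D : C) (f : mor A B) : (0 : mor B D) \co f = 0.
Proof. by apply: (addrI (0 \co f)); rewrite -mcompDl !addr0. Qed.

Lemma compm0 (A B D : C) (g : mor B D) : g \co (0 : mor A B) = 0.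
Proof. by apply: (addrI (g \co 0)); rewrite -mcompDr !addr0. Qed.

Lemma compNm (A B D : C) (g : mor B D) (f : mor A B) :
  (- g) \co f = - (g \co f).
Proof. by apply: (addrI (g \co f)); rewrite -mcompDl !subrr comp0m. Qed.

Lemma compmN (A B D : C) (g : mor B D) (f : mor A B) :
  g \co (- f) = - (g \co f).
Proof. by apply: (addrI (g \co f)); rewrite -mcompDr !subrr compm0. Qed.

Lemma compBm (A B D : C) (g g' : mor B D) (f : mor A B) :
  (g - g') \co f = g \co f - g' \co f.
Proof. by rewrite mcompDl compNm. Qed.

Lemma compmB (A B D : C) (g : mor B D) (f f' : mor A B) :
  g \co (f - f') = g \co f - g \co f'.
Proof. by rewrite mcompDr compmN. Qed.

Lemma is_iso_idm (A : C) : is_iso (idm A).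
Proof. by exists (idm A); rewrite mcomp1m. Qed.

Lemma is_iso_two_sided (A B : C) (f : mor A B) (g : mor B A) :
  is_iso (g \co f) -> is_iso (f \co g) -> is_iso f.
Proof.
move=> [h [hgf _]] [k [_ fgk]].
have lr : h \co g = g \co k.
  by rewrite -[h \co g]mcompm1 -fgk !mcompA -(mcompA h g f) hgf mcomp1m.
by exists (h \co g); split; [rewrite -mcompA | rewrite lr mcompA].
Qed.

Lemma is_iso_unipotent (A : C) (b : mor A A) :
  (b - idm A) \co (b - idm A) = 0 -> is_iso b.
Proof.
set n := b - idm A => nn; have -> : b = idm A + n by rewrite addrC subrK.
exists (idm A - n); split.
  by rewrite compBm mcomp1m mcompDr nn mcompm1 addr0 addrK.
by rewrite compmB mcompm1 mcompDl nn mcomp1m addr0 addrK.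
Qed.

Definition swap (A B : C) : mor (A \osum B) (B \osum A) :=
  in2 B A \co pr1 A B + in1 B A \co pr2 A B.

Lemma swap_in1 (A B : C) : swap A B \co in1 A B = in2 B A.
Proof. by rewrite mcompDl -!mcompA pr1_in1 pr2_in1 compm0 addr0 mcompm1. Qed.

Lemma swap_in2 (A B : C) : swap A B \co in2 A B = in1 B A.
Proof. by rewrite mcompDl -!mcompA pr1_in2 pr2_in2 compm0 add0r mcompm1. Qed.

Lemma swapK (A B : C) : swap B A \co swap A B = idm (A \osum B).
Proof. by rewrite {2}/swap mcompDr !mcompA swap_in1 swap_in2 in_pr_id. Qed.

Lemma pr1_swap (A B : C) : pr1 B A \co swap A B = pr2 A B.
Proof. by rewrite mcompDr !mcompA pr1_in2 pr1_in1 comp0m mcomp1m add0r. Qed.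

End Additive.

Section Extriangulated.
Local Open Scope ring_scope.
Variable C : extdata.
Hypothesis CE : extriangulated C.

Let CB := extri_bifunctor CE.
Let CR := extri_realization CE.
Let CRr := add_realization CR.

(** * Exact sequences of an E-triangle *)

Lemma push_ext0 (D A A' : C) (a : mor A A') : push a (0 : Ext D A) = 0.
Proof.
by apply: (addrI (push a (0 : Ext D A))); rewrite -(push_ext_add CB) !addr0.
Qed.

Lemma pull_ext0 (D D' A : C) (c : mor D' D) : pull c (0 : Ext D A) = 0.
Proof.
by apply: (addrI (pull c (0 : Ext D A))); rewrite -(pull_ext_add CB) !addr0.
Qed.

Lemma push0 (D A A' : C) (d : Ext D A) : push (0 : mor A A') d = 0.
Proof.
by apply: (addrI (push (0 : mor A A') d)); rewrite -(push_mor_add CB) !addr0.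
Qed.

Lemma pull0 (D D' A : C) (d : Ext D A) : pull (0 : mor D' D) d = 0.
Proof.
by apply: (addrI (pull (0 : mor D' D) d)); rewrite -(pull_mor_add CB) !addr0.
Qed.

Lemma realizes0_swap (A D : C) :
  realizes (in2 D A) (pr1 D A) (0 : Ext D A).
Proof.
apply: (realizes_equiv CRr (realizes0 CR A D)).
exists (swap A D); split; [|exact: swap_in1|exact: pr1_swap].
by exists (swap D A); rewrite !swapK.
Qed.

(** Each exactness statement below is proved by comparing the E-triangle with
    a split one that has a zero end, by means of (ET3), its dual, or the
    lifting property of a realization. *)
Section OneTriangle.
Variables (A B D : C) (x : mor A B) (y : mor B D) (d : Ext D A).
Hypothesis xyd : realizes x y d.

Lemma infl_weak_coker (V : C) (h : mor B V) :
  h \co x = 0 -> exists k, k \co y = h.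
Proof.
move=> hx.
have [|c [cy _]] := @extri_ET3 _ CE _ _ _ _ _ _ _ _ _ _ _ _ (0 : mor A zob)
  (in2 zob V \co h) xyd (realizes0 CR zob V).
  by rewrite -mcompA hx !compm0.
by exists c; rewrite cy mcompA pr2_in2 mcomp1m.
Qed.

Lemma defl_weak_ker (V : C) (h : mor V B) :
  y \co h = 0 -> exists k, x \co k = h.
Proof.
move=> yh.
have [|a [xa _]] := @extri_ET3op _ CE _ _ _ _ _ _ _ _ _ _ _ _
  (h \co pr1 V zob) (0 : mor zob D) (realizes0 CR V zob) xyd.
  by rewrite mcompA yh !comp0m.
by exists a; rewrite -xa -mcompA pr1_in1 mcompm1.
Qed.

Lemma push_infl : push x d = 0.
Proof.
have [//|c [_]] := @extri_ET3 _ CE _ _ _ _ _ _ _ _ _ _ _ _ x (in1 B zob)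
  xyd (realizes0 CR B zob).
by rewrite /ext_mor pull_ext0.
Qed.

Lemma pull_defl : pull y d = 0.
Proof.
have [//|a [_]] := @extri_ET3op _ CE _ _ _ _ _ _ _ _ _ _ _ _ (pr2 zob B) y
  (realizes0 CR zob B) xyd.
by rewrite /ext_mor push_ext0 => <-.
Qed.

Lemma extend_along_infl (V : C) (a : mor A V) :
  push a d = 0 -> exists k, k \co x = a.
Proof.
move=> ad.
have [|b [bx _]] := realizes_mor CRr (a := a) (c := (0 : mor D zob)) xyd
  (realizes0 CR V zob).
  by rewrite /ext_mor ad pull_ext0.
by exists (pr1 V zob \co b); rewrite -mcompA bx mcompA pr1_in1 mcomp1m.
Qed.

Lemma lift_along_defl (V : C) (c : mor V D) :
  pull c d = 0 -> exists k, y \co k = c.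
Proof.
move=> cd.
have [|b [_ yb]] := realizes_mor CRr (a := (0 : mor zob A)) (c := c)
  (realizes0 CR zob V) xyd.
  by rewrite /ext_mor cd push_ext0.
by exists (b \co in2 zob V); rewrite mcompA yb -mcompA pr2_in2 mcompm1.
Qed.

Lemma defl_infl0 : y \co x = 0.
Proof.
have [|b [bx yb]] := realizes_mor CRr (a := idm A) (c := (0 : mor zob D))
  (realizes0 CR A zob) xyd.
  by rewrite /ext_mor pull0 push_ext0.
by rewrite -[x]mcompm1 -bx mcompA yb comp0m comp0m.
Qed.

(** With n = e - 1, n^* d = 0 gives n = y l, and n y = 0; so n n = n y l = 0. *)
Lemma cone_unipotent_iso (e : mor D D) : e \co y = y -> pull e d = d -> is_iso e.
Proof.
move=> ey ed; pose n := e - idm D.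
have ny : n \co y = 0 by rewrite compBm ey mcomp1m subrr.
have [|l nl] := @lift_along_defl _ n.
  apply: (addIr d); rewrite -{2}[d](pull_id CB) -(pull_mor_add CB) subrK.
  by rewrite ed add0r.
have nn : n \co n = 0 by rewrite -{2}nl mcompA ny comp0m.
exact: is_iso_unipotent.
Qed.

End OneTriangle.

(** If x_* t = 0, then x extends to the middle term of t, and (ET3) turns this
    extension into a map c from V with c^* d = t. *)
Lemma ext_connecting (A B D V : C) (x : mor A B) (y : mor B D) (d : Ext D A)
    (t : Ext V A) :
  realizes x y d -> push x t = 0 -> exists c : mor V D, pull c d = t.
Proof.
have [M [p [q pqt]]] := realizes_ex CRr t => xyd xt.
have [m mp] := extend_along_infl pqt xt.
have [|c [_ tc]] := @extri_ET3 _ CE _ _ _ _ _ _ _ _ _ _ _ _ (idm A) m pqt xyd.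
  by rewrite mcompm1.
by exists c; rewrite -tc (push_id CB).
Qed.

(** Middle exactness is automatic, so exactness on Homs amounts to the two
    conditions at the ends. *)
Lemma hom_to_exactP (A B D V : C) (x : mor A B) (y : mor B D) (d : Ext D A) :
  realizes x y d ->
  (forall h : mor D V, h \co y = 0 -> h = 0) ->
  (forall a : mor A V, exists h, h \co x = a) ->
  hom_to_exact V x y.
Proof.
move=> xyd y_inj x_surj; split=> [h h' /= hh'|h|//].
  by apply/subr0_eq/y_inj; rewrite compBm hh' subrr.
split=> [|[k <-]]; first exact: infl_weak_coker xyd _ _.
by rewrite -mcompA (defl_infl0 xyd) compm0.
Qed.

Lemma hom_from_exactP (A B D V : C) (x : mor A B) (y : mor B D) (d : Ext D A) :
  realizes x y d ->
  (forall h : mor V A, x \co h = 0 -> h = 0) ->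
  (forall c : mor V D, exists h, y \co h = c) ->
  hom_from_exact V x y.
Proof.
move=> xyd x_inj y_surj; split=> [h h' /= hh'|h|//].
  by apply/subr0_eq/x_inj; rewrite compmB hh' subrr.
split=> [|[k <-]]; first exact: defl_weak_ker xyd _ _.
by rewrite mcompA (defl_infl0 xyd) comp0m.
Qed.

Lemma hom_to_inj (A B D V : C) (x : mor A B) (y : mor B D) (h : mor D V) :
  hom_to_exact V x y -> h \co y = 0 -> h = 0.
Proof. by case=> y_inj _ _ hy; apply: y_inj; rewrite /= hy comp0m. Qed.

Lemma hom_from_inj (A B D V : C) (x : mor A B) (y : mor B D) (h : mor V A) :
  hom_from_exact V x y -> x \co h = 0 -> h = 0.
Proof. by case=> x_inj _ _ xh; apply: x_inj; rewrite /= xh compm0. Qed.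

(** (ET3) gives maps in both directions, and both composites are unipotent. *)
Lemma cone_iso (A B D A' B' D' : C)
    (x : mor A B) (y : mor B D) (d : Ext D A)
    (x' : mor A' B') (y' : mor B' D') (d' : Ext D' A')
    (a : mor A A') (b : mor B B') :
  realizes x y d -> realizes x' y' d' -> is_iso a -> is_iso b ->
  b \co x = x' \co a -> exists c : mor D D', is_iso c /\ c \co y = y' \co b.
Proof.
move=> xyd xyd' [a' [a'a aa']] [b' [b'b bb']] bx.
have bx' : b' \co x' = x \co a'.
  by rewrite -[x']mcompm1 -aa' !mcompA -(mcompA b' x' a) -bx !mcompA b'b mcomp1m.
have [c [cy dc]] := extri_ET3 CE xyd xyd' bx.
have [c' [cy' dc']] := extri_ET3 CE xyd' xyd bx'.
exists c; split=> //; apply: (is_iso_two_sided (g := c')).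
  apply: (cone_unipotent_iso xyd).
    by rewrite -mcompA cy mcompA cy' -mcompA b'b mcompm1.
  by rewrite (pull_comp CB) -dc' -(push_pull CB) -dc -(push_comp CB) a'a (push_id CB).
apply: (cone_unipotent_iso xyd').
  by rewrite -mcompA cy' mcompA cy -mcompA bb' mcompm1.
by rewrite (pull_comp CB) -dc -(push_pull CB) -dc' -(push_comp CB) aa' (push_id CB).
Qed.

(** * Pushouts of inflations *)

(** With n = b - 1, n x = 0 gives n = k y, and y n = 0; so n n = k y n = 0. *)
Lemma middle_unipotent_iso (A B D : C) (x : mor A B) (y : mor B D)
    (d : Ext D A) (b : mor B B) :
  realizes x y d -> b \co x = x -> y \co b = y -> is_iso b.
Proof.
move=> xyd bx yb; pose n := b - idm B.
have [|k kn] := @infl_weak_coker _ _ _ _ _ _ xyd _ n.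
  by rewrite compBm bx mcomp1m subrr.
have nn : n \co n = 0.
  by rewrite -{1}kn -mcompA compmB yb mcompm1 subrr compm0.
exact: is_iso_unipotent.
Qed.

Lemma realizes_push_iso (A A' B D : C) (x : mor A B) (y : mor B D)
    (d : Ext D A) (a : mor A A') (a' : mor A' A) :
  a' \co a = idm A -> a \co a' = idm A' ->
  realizes x y d -> realizes (x \co a') y (push a d).
Proof.
move=> a'a aa' xyd.
have [M [z [w zwd]]] := realizes_ex CRr (push a d).
have [|b [bx wb]] := realizes_mor CRr (a := a) (c := idm D) xyd zwd.
  by rewrite /ext_mor (pull_id CB).
have [|b' [bz yb']] := realizes_mor CRr (a := a') (c := idm D) zwd xyd.
  by rewrite /ext_mor (pull_id CB) -(push_comp CB) a'a (push_id CB).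
rewrite mcomp1m in wb; rewrite mcomp1m in yb'.
apply: (realizes_equiv CRr zwd); exists b'; split=> //.
apply: (is_iso_two_sided (g := b)).
  apply: (middle_unipotent_iso zwd).
    by rewrite -mcompA bz mcompA bx -mcompA aa' mcompm1.
  by rewrite mcompA wb.
apply: (middle_unipotent_iso xyd).
  by rewrite -mcompA bx mcompA bz -mcompA a'a mcompm1.
by rewrite mcompA yb'.
Qed.

(** The dual of (ET4), applied to a deflation followed by a split one: if
    the class t has middle term M, then M is an extension of the complement B
    by any middle term of the restriction of t along i. *)
Lemma split_quotient_of_middle (A B D E K M : C)
    (j : mor A M) (p : mor M D) (t : Ext D A)
    (i : mor K D) (q : mor D B) (s : mor B D) (x : mor A E) (y : mor E K) :
  realizes j p t -> realizes i q (0 : Ext B K) -> q \co s = idm B ->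
  realizes x y (pull i t) ->
  exists h, realizes h (q \co p) (push x (pull s t)).
Proof.
move=> jpt iq0 qs xyt.
have [H [h [d [u [v [hd _ vu _ qd]]]]]] := extri_ET4op CE iq0 jpt.
have [b [[b' [b'b bb']] bv _]] := realizes_uniq CRr vu xyt.
exists (h \co b'); rewrite -bv (push_comp CB) (push_pull CB) -qd -(pull_comp CB).
rewrite qs (pull_id CB); exact: realizes_push_iso.
Qed.

(** The middle term M of the class on D1 + D2 with components d1 and d2 is an
    extension of D1 by B2 and of D2 by B1.  The first extension has class
    x2_* d1 = 0, so M is B2 + D1, and the second one is then the cobase change
    of d2 along x1. *)
Lemma cobase_change_splitting (A B1 B2 D1 D2 : C)
    (x1 : mor A B1) (y1 : mor B1 D1) (d1 : Ext D1 A)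
    (x2 : mor A B2) (y2 : mor B2 D2) (d2 : Ext D2 A) :
  realizes x1 y1 d1 -> realizes x2 y2 d2 -> push x2 d1 = 0 ->
  exists (p : mor B1 (B2 \osum D1)) (q : mor (B2 \osum D1) D2),
    realizes p q (push x1 d2).
Proof.
move=> xyd1 xyd2 x2d1.
pose t : Ext (D1 \osum D2) A := pull (pr1 D1 D2) d1 + pull (pr2 D1 D2) d2.
have t1 : pull (in1 D1 D2) t = d1.
  rewrite (pull_ext_add CB) -!(pull_comp CB) pr1_in1 pr2_in1 pull0.
  by rewrite (pull_id CB) addr0.
have t2 : pull (in2 D1 D2) t = d2.
  rewrite (pull_ext_add CB) -!(pull_comp CB) pr1_in2 pr2_in2 pull0.
  by rewrite (pull_id CB) add0r.
have [M [j [p jpt]]] := realizes_ex CRr t.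
have [|h1 h1M] := split_quotient_of_middle (x := x1) (y := y1) jpt
  (realizes0 CR D1 D2) (pr2_in2 D1 D2); first by rewrite t1.
have [|h2 h2M] := split_quotient_of_middle (x := x2) (y := y2) jpt
  (realizes0_swap D2 D1) (pr1_in1 D1 D2); first by rewrite t2.
rewrite t2 in h1M; rewrite t1 x2d1 in h2M.
have [b [[b' [b'b bb']] _ _]] := realizes_uniq CRr h2M (realizes0 CR B2 D1).
exists (b \co h1), (pr2 D1 D2 \co p \co b').
apply: (realizes_equiv CRr h1M); exists b; split=> //; first by exists b'.
by rewrite -mcompA b'b mcompm1.
Qed.


(** * Triangles of a proper class *)

Variable xi : tri_class C.
Hypothesis xiP : proper_class xi.
Variable W : C -> Prop.

Let xi_realizes := proper_tri xiP.

(** Let q be the deflation in a triangle of class v^* e, which is in xi by base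
    change.  Since x_* d2 = v^* e, the class q^* d2 is killed by x_*, hence is a
    base change of d and belongs to xi; so d2 does too, by saturation. *)
Lemma xi_composite (A B D G F : C) (x : mor A B) (y : mor B D) (d : Ext D A)
    (g : mor B G) (f : mor G F) (e : Ext F B) :
  xi x y d -> xi g f e ->
  exists (H : C) (h : mor G H) (d2 : Ext H A) (u : mor D H) (v : mor H F),
    [/\ xi (g \co x) h d2, realizes u v (push y e),
        h \co g = u \co y & v \co h = f].
Proof.
move=> xyd gfe.
have [H [h [d2 [u [v [hd2 [hg vh] uv _ xd2]]]]]] :=
  extri_ET4 CE (xi_realizes xyd) (xi_realizes gfe).
exists H, h, d2, u, v; split=> //.
have [M [p [q pq]]] := realizes_ex CRr (pull v e).
have xi_pq := proper_base xiP gfe pq.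
have [|c cd] := @ext_connecting _ _ _ _ _ _ _ (pull q d2) (xi_realizes xyd).
  by rewrite (push_pull CB) xd2 (pull_defl pq).
have [N [m [n mn]]] := realizes_ex CRr (pull q d2).
apply: (proper_saturated xiP hd2 xi_pq (m := m) (e := n)).
by rewrite -cd in mn *; apply: proper_base xyd mn.
Qed.

Section CompositeExactness.
Variables (V A B D G F H : C) (x : mor A B) (y : mor B D)
  (g : mor B G) (f : mor G F) (h : mor G H) (u : mor D H) (v : mor H F)
  (d : Ext H A) (e : Ext F D).
Hypotheses (gxh : realizes (g \co x) h d) (uv : realizes u v e).
Hypotheses (hg : h \co g = u \co y) (vh : v \co h = f).

Lemma composite_hom_to_exact :
  hom_to_exact V x y -> hom_to_exact V g f -> hom_to_exact V (g \co x) h.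
Proof.
move=> xy gf; apply: (hom_to_exactP gxh) => [s sh | a].
  have su : s \co u = 0.
    by apply: (hom_to_inj xy); rewrite -mcompA -hg mcompA sh comp0m.
  have [t ts] := infl_weak_coker uv su.
  suff t0 : t = 0 by rewrite -ts t0 comp0m.
  by apply: (hom_to_inj gf); rewrite -vh mcompA ts.
have [_ _ /(_ a)[b /= bx]] := xy; have [_ _ /(_ b)[k /= kg]] := gf.
by exists k; rewrite mcompA kg.
Qed.

(** A map r to H is lifted in two steps: subtracting a lift of v r along f
    leaves a map that factors through u, and this one lifts along y. *)
Lemma composite_hom_from_exact :
  hom_from_exact V x y -> hom_from_exact V g f -> hom_from_exact V (g \co x) h.
Proof.
move=> xy gf; apply: (hom_from_exactP gxh) => [s gxs | r].
  by apply: (hom_from_inj xy); apply: (hom_from_inj gf); rewrite mcompA.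
have [_ _ /(_ (v \co r))[l /= fl]] := gf.
have [|t ut] := @defl_weak_ker _ _ _ _ _ _ uv _ (r - h \co l).
  by rewrite compmB mcompA vh fl subrr.
have [_ _ /(_ t)[z /= yz]] := xy.
by exists (l + g \co z); rewrite mcompDr mcompA hg -mcompA yz ut addrC subrK.
Qed.

End CompositeExactness.

Section CobaseChange.
Variables (A B1 B2 D1 D2 M : C) (x1 : mor A B1) (y1 : mor B1 D1)
  (d1 : Ext D1 A) (x2 : mor A B2) (y2 : mor B2 D2) (d2 : Ext D2 A)
  (p : mor B1 M) (q : mor M D2).
Hypotheses (xyd1 : realizes x1 y1 d1) (xyd2 : realizes x2 y2 d2).
Hypothesis pq : realizes p q (push x1 d2).

Lemma cobase_map : exists b : mor B2 M, b \co x2 = p \co x1 /\ q \co b = y2.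
Proof.
have [|b [bx qb]] := realizes_mor CRr (a := x1) (c := idm D2) xyd2 pq.
  by rewrite /ext_mor (pull_id CB).
by exists b; rewrite qb mcomp1m.
Qed.

Lemma cobase_hom_to_exact (V : C) :
  hom_to_exact V x2 y2 -> hom_to_exact V p q.
Proof.
move=> xy; have [b [_ qb]] := cobase_map.
apply: (hom_to_exactP pq) => [t tq | s].
  by apply: (hom_to_inj xy); rewrite -qb mcompA tq comp0m.
apply: (extend_along_infl pq); have [_ _ /(_ (s \co x1))[m /= mx]] := xy.
by rewrite -(push_comp CB) -mx (push_comp CB) (push_infl xyd2) push_ext0.
Qed.

(** Injectivity on maps s from V is the point: if p s = 0, then y1 s = 0
    because y1 extends along p, so s = x1 t; and as x2_* d1 = 0, x2 extends to
    B1, hence to M, so that x2 t = 0 and t = 0. *)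
Lemma cobase_hom_from_exact (V : C) :
  push x2 d1 = 0 -> hom_from_exact V x2 y2 -> hom_from_exact V p q.
Proof.
move=> x2d1 xy; have [b [_ qb]] := cobase_map.
apply: (hom_from_exactP pq) => [s ps | c]; last first.
  have [_ _ /(_ c)[l /= yl]] := xy.
  by exists (b \co l); rewrite mcompA qb.
have [|k kp] := @extend_along_infl _ _ _ _ _ _ pq _ y1.
  by rewrite -(push_comp CB) (defl_infl0 xyd1) push0.
have [|t ts] := @defl_weak_ker _ _ _ _ _ _ xyd1 _ s.
  by rewrite -kp -mcompA ps compm0.
have [m mx] := extend_along_infl xyd1 x2d1.
have [|n np] := @extend_along_infl _ _ _ _ _ _ pq _ m.
  by rewrite -(push_comp CB) mx (push_infl xyd2).
suff t0 : t = 0 by rewrite -ts t0 compm0.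
by apply: (hom_from_inj xy); rewrite -mx -np -!mcompA ts ps compm0.
Qed.

End CobaseChange.

(** The proposition F will be the hypothesis of part (2): carrying it inside
    the triangles makes a single construction serve for both parts. *)
Record exact_tri (F : Prop) (A B D : C) := ExactTri {
  tri_infl : mor A B;
  tri_defl : mor B D;
  tri_ext : Ext D A;
  tri_xi : xi tri_infl tri_defl tri_ext;
  tri_to_exact : to_exact W tri_infl tri_defl;
  tri_from_exact : F -> from_exact W tri_infl tri_defl
}.

Section ExactTriangles.
Variable F : Prop.

Lemma exact_tri_absorb (A B1 B2 D1 D2 : C) (x1 : mor A B1) (y1 : mor B1 D1)
    (d1 : Ext D1 A) (T : exact_tri F A B2 D2) :
  realizes x1 y1 d1 -> push (tri_infl T) d1 = 0 ->
  inhabited (exact_tri F B1 (B2 \osum D1) D2).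
Proof.
case: T => x2 y2 d2 xi2 to2 from2 /= xyd1 x2d1.
have xyd2 := xi_realizes xi2.
have [p [q pq]] := cobase_change_splitting xyd1 xyd2 x2d1.
constructor; apply: (@ExactTri F _ _ _ p q (push x1 d2)).
- exact: proper_cobase xi2 pq.
- by move=> V WV; apply: (cobase_hom_to_exact xyd2 pq); apply: to2.
move=> /from2 from V WV.
exact: (cobase_hom_from_exact xyd1 xyd2 pq x2d1 (from V WV)).
Qed.

(** This is cobase change along A -> V + A, seen as absorbing into the triangle
    T the split triangle A -> V + A -> V. *)
Lemma exact_tri_dsum (A B D V : C) :
  exact_tri F A B D -> inhabited (exact_tri F (V \osum A) (B \osum V) D).
Proof.
move=> T; exact: (exact_tri_absorb (realizes0_swap A V) (push_ext0 V (tri_infl T))).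
Qed.

(** The composite of R and S comes with a triangle D -> H -> K of class y_* e,
    where e is the class of S.  As V is in W, the map B -> D -> V extends to G,
    so the inflation of T sends y_* e to 0, and T can be absorbed. *)
Lemma exact_tri_compose (A B D G K V E : C)
    (R : exact_tri F A B D) (S : exact_tri F B G K) (T : exact_tri F D V E) :
  W V -> exists H, inhabited (exact_tri F A G H) /\
    inhabited (exact_tri F H (V \osum K) E).
Proof.
case: R => x y d xi1 to1 from1; case: S => g f e xi2 to2 from2 WV.
have [H [h [d2 [u [v [xih uv hg vh]]]]]] := xi_composite xi1 xi2.
exists H; split; [constructor | apply: (exact_tri_absorb uv (T := T))].
  have gxh := xi_realizes xih.
  apply: (ExactTri xih) => [X WX | ft X WX].
    exact: (composite_hom_to_exact gxh uv hg vh (to1 X WX) (to2 X WX)).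
  exact: (composite_hom_from_exact gxh uv hg vh (from1 ft X WX) (from2 ft X WX)).
have [_ _ /(_ (tri_infl T \co y))[w /= wg]] := to2 V WV.
by rewrite -(push_comp CB) -wg (push_comp CB) (push_infl (xi_realizes xi2)) push_ext0.
Qed.

(** * Splicing the two coresolutions *)

Section Splicing.
Variables (Y Y0 Y1 : C) (T : exact_tri F Y Y0 Y1).
Variables (X0 K0 X1 K1 : nat -> C).
Hypothesis X1_W : forall i, W (X1 i).
Hypothesis R0 : forall i, exact_tri F (cosyzygy Y0 K0 i) (X0 i) (K0 i).
Hypothesis R1 : forall i, exact_tri F (cosyzygy Y1 K1 i) (X1 i) (K1 i).

(** The invariant of the construction.  Stage 0 is (T) followed by the first
    triangle of the coresolution of Y0; at stage i + 1 the middle term is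
    X1 i + K0 i. *)
Record stage (i : nat) := Stage {
  syz : C;
  mid : C;
  syz_tri : exact_tri F syz mid (cosyzygy Y1 K1 i);
  mid_tri : exact_tri F mid (shifted_dsum X0 X1 i) (K0 i)
}.

Lemma stage_step (i : nat) (s : stage i) :
  inhabited {s' : stage i.+1 & exact_tri F (syz s) (shifted_dsum X0 X1 i) (syz s')}.
Proof.
case: s => H Z S1 S2 /=.
have [H' [[T1] [T2]]] := exact_tri_compose S1 S2 (R1 i) (X1_W i).
have [T3] := exact_tri_dsum (X1 i) (R0 i.+1).
by constructor; exists (@Stage i.+1 H' (X1 i \osum K0 i) T2 T3).
Qed.

Definition next_stage (i : nat) (s : stage i) :
    {s' : stage i.+1 & exact_tri F (syz s) (shifted_dsum X0 X1 i) (syz s')} :=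
  proj1_sig (constructive_indefinite_description (fun=> True)
    (let: inhabits t := stage_step s in ex_intro _ t I)).

Fixpoint stages (i : nat) : stage i :=
  if i is j.+1 then projT1 (next_stage (stages j)) else @Stage 0 Y Y0 T (R0 0%N).

Definition spliced_tri (i : nat) :
    exact_tri F (syz (stages i)) (shifted_dsum X0 X1 i) (syz (stages i.+1)) :=
  projT2 (next_stage (stages i)).

End Splicing.
End ExactTriangles.

Lemma xi_exact_with_splice (Q : forall A B D : C, mor A B -> mor B D -> Prop)
    (X H : nat -> C) (g : forall i, mor (H i) (X i))
    (f : forall i, mor (X i) (H i.+1)) (e : forall i, Ext (H i.+1) (H i)) :
  (forall i, xi (g i) (f i) (e i)) -> (forall i, Q _ _ _ (g i) (f i)) ->
  xi_exact_with xi Q (g 0%N) (fun i => g i.+1 \co f i).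
Proof.
move=> xiT QT; exists (fun i => H i.+1).
(* H i and the i-th cosyzygy agree only after case analysis on i. *)
exists (fun i => match i return mor (cosyzygy (H 0%N) (fun i => H i.+1) i) (X i)
                 with 0 => g 0%N | j.+1 => g j.+1 end), f.
exists (fun i => match i return Ext (H i.+1) (cosyzygy (H 0%N) (fun i => H i.+1) i)
                 with 0 => e 0%N | j.+1 => e j.+1 end).
by split=> // -[|i]; [apply: xiT | apply: xiT | apply: QT | apply: QT].
Qed.

(** Two decompositions of the same complex have isomorphic cosyzygies: cones
    of an inflation are isomorphic, and the isomorphism is compatible with the
    next inflations since the deflations of a C(-, W)-exact decomposition are
    epic with respect to objects of W. *)
Lemma decomposition_iso (A : C) (X : nat -> C)
    (K K' : nat -> C) (g : forall i, mor (cosyzygy A K i) (X i))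
    (f : forall i, mor (X i) (K i)) (e : forall i, Ext (K i) (cosyzygy A K i))
    (g' : forall i, mor (cosyzygy A K' i) (X i))
    (f' : forall i, mor (X i) (K' i)) (e' : forall i, Ext (K' i) (cosyzygy A K' i)) :
  (forall i, W (X i)) ->
  (forall i, xi (g i) (f i) (e i)) -> (forall i, to_exact W (g i) (f i)) ->
  (forall i, xi (g' i) (f' i) (e' i)) ->
  g 0%N = g' 0%N -> (forall i, g i.+1 \co f i = g' i.+1 \co f' i) ->
  forall i, exists c c',
    [/\ is_iso c, is_iso c', g' i \co c = g i & c' \co f i = f' i].
Proof.
move=> WX xiT toT xiT' g0 gf i.
suff [c [iso_c gc]] : exists c, is_iso c /\ g' i \co c = g i.
  have [|c' [iso_c' cf]] := cone_iso (xi_realizes (xiT i)) (xi_realizes (xiT' i))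
    iso_c (is_iso_idm (X i)); first by rewrite mcomp1m.
  by exists c, c'; split=> //; rewrite cf mcompm1.
elim: i => [|i [c [iso_c gc]]].
  by exists (idm A); rewrite mcompm1; split; first exact: is_iso_idm.
have [|c' [iso_c' cf]] := cone_iso (xi_realizes (xiT i)) (xi_realizes (xiT' i))
  iso_c (is_iso_idm (X i)); first by rewrite mcomp1m.
exists c'; split=> //; apply/subr0_eq.
apply: (hom_to_inj (toT i _ (WX i.+1))).
by rewrite compBm -mcompA cf mcompm1 gf subrr.
Qed.

Lemma from_exact_iso (A A' B D D' : C) (x : mor A B) (y : mor B D) (d : Ext D A)
    (x' : mor A' B) (y' : mor B D') (c : mor A A') (c' : mor D D') :
  realizes x y d -> is_iso c -> is_iso c' -> x' \co c = x -> c' \co y = y' ->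
  from_exact W x' y' -> from_exact W x y.
Proof.
move=> xyd [b [bc _]] [b' [bc' _]] xc cy from V WV.
apply: (hom_from_exactP xyd) => [h xh | k].
  rewrite -[h]mcomp1m -bc -mcompA (_ : c \co h = 0) ?compm0 //.
  by apply: (hom_from_inj (from V WV)); rewrite mcompA xc.
have [_ _ /(_ (c' \co k))[l /= yl]] := from V WV; exists l.
by rewrite -[k]mcomp1m -bc' -mcompA -yl -cy !mcompA bc' mcomp1m.
Qed.

(** The decomposition given by coproperness also serves for
    C(W, -)-exactness, which is carried over from the other decomposition by
    the isomorphisms between them. *)
Lemma coproper_exact_tri (F : Prop) (A : C) (X : nat -> C)
    (r : mor A (X 0%N)) (d : forall i, mor (X i) (X i.+1)) :
  coproper_coresolution xi W r d -> (F -> complex_from_exact xi W r d) ->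
  exists K, inhabited (forall i, exact_tri F (cosyzygy A K i) (X i) (K i)).
Proof.
move=> [[WX _] [K [g [f [e [g0 gf xiT toT]]]]]] from_r.
exists K; constructor=> i.
apply: (ExactTri (xiT i) (toT i)) => /from_r.
move=> [K' [g' [f' [e' [g0' gf' xiT' fromT]]]]].
have [|j|c [c' [iso_c iso_c' gc cf]]] := decomposition_iso WX xiT toT xiT' _ _ i.
- by rewrite g0 g0'.
- by rewrite gf gf'.
exact: from_exact_iso (xi_realizes (xiT i)) iso_c iso_c' gc cf (fromT i).
Qed.

End Extriangulated.

(** * The coresolution of Y *)

Theorem theorem3p9 (C : extdata) (xi : tri_class C)
    (C_extriangulated : extriangulated C)
    (xi_proper : proper_class xi)
    (enough_proj : enough_projectives xi)
    (enough_inj : enough_injectives xi)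
    (C_WIC : WIC C)
    (W : C -> Prop) (W_dsum : closed_dsum W)
    (Y Y0 Y1 : C) (x : mor Y Y0) (y : mor Y0 Y1) (delta : Ext Y1 Y)
    (T_xi : xi Y Y0 Y1 x y delta)
    (T_to_exact : to_exact W x y)
    (W0 : nat -> C) (r0 : mor Y0 (W0 0)) (d0 : forall i, mor (W0 i) (W0 i.+1))
    (R0_coproper : coproper_coresolution xi W r0 d0)
    (W1 : nat -> C) (r1 : mor Y1 (W1 0)) (d1 : forall i, mor (W1 i) (W1 i.+1))
    (R1_coproper : coproper_coresolution xi W r1 d1) :
  exists (r : mor Y (shifted_dsum W0 W1 0))
    (d : forall i, mor (shifted_dsum W0 W1 i) (shifted_dsum W0 W1 i.+1)),
    coproper_coresolution xi W r d /\
    (complex_from_exact xi W r0 d0 -> complex_from_exact xi W r1 d1 ->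
     from_exact W x y -> complex_from_exact xi W r d).
Proof.
pose F := [/\ complex_from_exact xi W r0 d0, complex_from_exact xi W r1 d1
  & from_exact W x y].
have [|K0 [R0]] := coproper_exact_tri (F := F) C_extriangulated xi_proper R0_coproper.
  by case.
have [|K1 [R1]] := coproper_exact_tri (F := F) C_extriangulated xi_proper R1_coproper.
  by case.
have T : exact_tri xi W F Y Y0 Y1 by apply: (ExactTri T_xi T_to_exact); case.
have [[[WX0 _] _] [[WX1 _] _]] := (R0_coproper, R1_coproper).
pose S := spliced_tri C_extriangulated xi_proper T WX1 R0 R1.
exists (tri_infl (S 0%N)), (fun i => tri_infl (S i.+1) \co tri_defl (S i)).
have splice Q := @xi_exact_with_splice C xi Q _ _ _ _ _ (fun i => tri_xi (S i)).
split; last first.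
  by move=> F0 F1 Fxy; apply: splice => i; apply: tri_from_exact.
split; last by apply: splice => i; apply: tri_to_exact.
split; last by apply: splice.
by case=> [|i]; [apply: WX0 | apply: W_dsum].
Qed.
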